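(* Let $n$ be a positive integer, let $a_1,\dots,a_n>0$ and $c_1,\dots,c_n$ be real numbers, and let $X_1,\dots,X_n$ be independent random variables with $X_j$ uniformly distributed in the interval $[c_j-a_j,c_j+a_j]$ for $j=1,\dots,n$. Then the density $f_n=\chi_1*\chi_2*\cdots*\chi_n$ of the sum $\sum_{j=1}^n X_j$ is given, for all real $x$, by $$f_n(x)=\frac{\displaystyle\sum_{\vec\varepsilon\in\{-1,1\}^n}\Big(x+\sum_{j=1}^n(\varepsilon_ja_j-c_j)\Big)^{n-1}\,\mathrm{sign}\Big(x+\sum_{j=1}^n(\varepsilon_ja_j-c_j)\Big)\prod_{j=1}^n\varepsilon_j}{\displaystyle (n-1)!\,2^{n+1}\prod_{j=1}^n a_j},$$ where the sum is over all $2^n$ vectors of signs $\vec\varepsilon=(\varepsilon_1,\dots,\varepsilon_n)$ with each $\varepsilon_j=\pm1$.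
   Context: The density of $X_j$ is normalized at jump discontinuities: $\chi_j:\mathbb{R}\to\mathbb{R}$ is defined by $2a_j\,\chi_j(x)=1$ if $|x-c_j|<a_j$, $2a_j\,\chi_j(x)=\tfrac12$ if $|x-c_j|=a_j$, and $2a_j\,\chi_j(x)=0$ if $|x-c_j|>a_j$. The density of the sum is taken to be the $n$-fold convolution $f_n=\chi_1*\cdots*\chi_n$ on $\mathbb{R}$, where $(f*g)(x)=\int_{-\infty}^{\infty}f(x-y)g(y)\,dy$; for $n=1$, $f_1=\chi_1$. The function $\mathrm{sign}$ is defined by $\mathrm{sign}(y)=1$ if $y>0$, $\mathrm{sign}(0)=0$, and $\mathrm{sign}(y)=-1$ if $y<0$. When $n=1$, $y^{n-1}=y^0=1$ for all real $y$. *)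

(* Defs.v *)
From HB Require Import structures.
From mathcomp Require Import all_boot all_order all_algebra.
From mathcomp Require Import all_classical all_reals all_analysis.

Set Implicit Arguments.
Unset Strict Implicit.
Unset Printing Implicit Defensive.

Import Order.TTheory GRing.Theory Num.Theory.
Import numFieldNormedType.Exports.

Local Open Scope classical_set_scope.
Local Open Scope ring_scope.

(* The values at the two jump points are the averages of the one-sided limits:
   the formula for [nfold_convolution] below holds at every real point, so
   this normalization cannot be replaced by that of [uniform_pdf]. *)
Definition chi (R : realType) (a c x : R) : R :=
  (if `|x - c| < a then 1 else if `|x - c| == a then 1 / 2 else 0) / (2 * a).

Definition convolution (R : realType) (f g : R -> R) (x : R) : R :=
  \int[@lebesgue_measure R]_y (f (x - y) * g y).

(* Bracketed to the left, ((f1 * f2) * f3) * ... ; a one-element list gives its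
   element. The value on the empty list is a dummy, as the unit of convolution
   is not a function. *)
Definition nfold_convolution (R : realType) (s : seq (R -> R)) : R -> R :=
  if s is f :: s' then foldl (@convolution R) f s' else fun=> 0.

Definition mutually_independent (d : measure_display) (T : measurableType d)
    (R : realType) (P : probability T R) (I : finType)
    (X : I -> {RV P >-> R}) : Prop :=
  forall (J : {set I}) (B : I -> set R), (forall i, measurable (B i)) ->
    P (\bigcap_(i in [set` J]) (X i @^-1` B i)) =
    (\prod_(i in J) P (X i @^-1` B i))%E.

(* Laws are compared on measurable sets only: the underlying set functions are
   unconstrained elsewhere. *)
Definition uniformly_distributed (d : measure_display) (T : measurableType d)
    (R : realType) (P : probability T R) (X : {RV P >-> R}) (l u : R) : Prop :=
  exists lu : l < u, forall B : set R, measurable B ->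
    distribution P X B = uniform_prob lu B.

(* [Y] is a bare function because a sum over ['I_n] of bundled random variables
   is not inferred to be one; measurable summands make it measurable. *)
Definition is_density (d : measure_display) (T : measurableType d)
    (R : realType) (P : probability T R) (Y : T -> R) (f : R -> R) : Prop :=
  [/\ measurable_fun setT f, forall x, 0 <= f x &
      forall B : set R, measurable B ->
        P (Y @^-1` B) = (\int[@lebesgue_measure R]_(x in B) (f x)%:E)%E].

(* Sign vectors in {-1,1}^n are encoded as boolean vectors. *)
Definition sign_of (R : realType) (b : bool) : R := if b then 1 else -1.

(* Main.v *)
Require Import Defs.
From HB Require Import structures.
From mathcomp Require Import all_boot all_order all_algebra.
From mathcomp Require Import all_classical all_reals all_analysis.
From mathcomp Require Import measurable_realfun ring lra.

Set Implicit Arguments.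
Unset Strict Implicit.
Unset Printing Implicit Defensive.

Import Order.TTheory GRing.Theory Num.Theory.
Import numFieldNormedType.Exports.

Local Open Scope classical_set_scope.
Local Open Scope ring_scope.

(* With f bounded, (f * chi)(x) is the mean of f(x - y) for y uniform on
   [c - a, c + a]; by Fubini and translation invariance, adding an independent
   uniform variable to a variable of density f thus produces the density f * chi.
   For the formula, let Phi_k(y) = y^k sign(y). As Phi_(k+1) / (k+1) is a
   primitive of Phi_k (for k = 0, away from 0), convolving a translate of Phi_k
   with chi yields a difference of two translates of Phi_(k+1): these are the two
   values of the new sign, and induction on n concludes. *)

(** * Translation invariance of Lebesgue measure and of nonnegative integrals *)

(** Lebesgue measure is determined by its values on half-open intervals, and a shift pulls such an
    interval back to one of the same length. *)
Lemma pushforward_lebesgueB (R : realType) (y : R) (A : set R) : measurable A ->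
  pushforward lebesgue_measure
    ((fun x : R => x - y) : measurableTypeR R -> measurableTypeR R) A =
  lebesgue_measure A.
Proof.
have my : measurable_fun setT
    ((fun x : R => x - y) : measurableTypeR R -> measurableTypeR R).
  exact: measurable_funB.
move=> mA; apply/esym.
pose my_mixin := isMeasurableFun.Build _ _ _ _ _ my.
pose my_pack : {mfun _ >-> _} := HB.pack
  ((fun x : R => x - y) : measurableTypeR R -> measurableTypeR R) my_mixin.
apply: (@lebesgue_measure_unique R (pushforward lebesgue_measure my_pack)) => //.
move=> _ [[a b]] _ <-.
rewrite /= /pushforward (_ : _ @^-1` _ = `](a + y), (b + y)]%classic);
  last first.
  by apply/seteqP; split=> x /=; rewrite !in_itv/= ltrBrDr lerBlDr.
rewrite !lebesgue_measure_itv/= !lte_fin ltrD2r; case: ifPn => // _.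
by rewrite -!EFinD; congr EFin; ring.
Qed.

Lemma measurable_preimageD (R : realType) (y : R) (B : set R) :
  measurable B -> measurable [set z : R | B (z + y)].
Proof.
move=> mB; rewrite -[X in measurable X]setTI.
by apply: (@measurable_funD _ _ _ setT id (cst y)).
Qed.

Lemma ge0_integral_shift (R : realType) (f : R -> R) (y : R) (B : set R) :
  measurable_fun setT f -> (forall x, 0 <= f x) -> measurable B ->
  (\int[lebesgue_measure]_(x in B) (f (x - y))%:E =
   \int[lebesgue_measure]_(x in [set z | B (z + y)%R]) (f x)%:E)%E.
Proof.
move=> mf f0 mB.
pose phi : measurableTypeR R -> measurableTypeR R := fun x : R => x - y.
have my : measurable_fun setT phi by exact: measurable_funB.
have {1}-> : B = phi @^-1` [set z | B (z + y)].
  by apply/seteqP; split=> x /=; rewrite /phi subrK.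
have mEf : measurable_fun setT (EFin \o f) by exact/measurable_EFinP.
have := @ge0_integral_pushforward _ _ _ _ _ _ my lebesgue_measure
  [set z | B (z + y)] (EFin \o f) (measurable_preimageD y mB)
  (measurable_funTS mEf).
move=> <-; last by move=> x _; rewrite lee_fin.
apply: eq_measure_integral => A mA _; exact: (pushforward_lebesgueB y mA).
Qed.

(** * The normalized uniform density *)

Lemma measurable_chi (R : realType) (a c : R) : measurable_fun setT (chi a c).
Proof.
have mB : measurable_fun setT (fun x : R => `|x - c|).
  by apply: measurableT_comp => //; exact: measurable_funB.
apply: measurable_funM => //; apply: measurable_fun_if => //.
  exact: measurable_fun_ltr.
apply: measurable_funTS; apply: measurable_fun_if => //.
exact: measurable_fun_eqr.
Qed.

Lemma chi_ge0 (R : realType) (a c x : R) : 0 < a -> 0 <= chi a c x.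
Proof.
move=> a0; rewrite /chi divr_ge0 ?mulr_ge0 ?(ltW a0)//.
by case: ifP => // _; case: ifP.
Qed.

Lemma chi_le (R : realType) (a c x : R) : 0 < a -> chi a c x <= (2 * a)^-1.
Proof.
move=> a0; rewrite /chi ler_piMl ?invr_ge0 ?mulr_ge0 ?(ltW a0)//.
by case: ifP => // _; case: ifP => // _; lra.
Qed.

(** The two functions differ only at the endpoints [c - a] and [c + a], a null set, so integrals do
    not see the normalization at the jumps. *)
Lemma chi_ae_uniform_pdf (R : realType) (a c : R) : 0 < a ->
  ae_eq lebesgue_measure setT (chi a c) (uniform_pdf (c - a) (c + a)).
Proof.
move=> a0; exists ([set c - a] `|` [set c + a]); split.
- exact: measurableU.
- by apply: countable_lebesgue_measure0; exact: finite_set_countable.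
move=> x /= /not_implyP[_]; apply: contra_notP => /not_orP[xl xr].
have neqa : `|x - c| == a = false.
  apply/negP; rewrite eqr_norml => /andP[/orP[]/eqP xca _].
    by apply: xr; rewrite -xca addrC subrK.
  by apply: xl; rewrite -xca addrC subrK.
rewrite /chi /uniform_pdf neqa.
have -> : c + a - (c - a) = 2 * a by ring.
rewrite (_ : (c - a <= x <= c + a) = (`|x - c| < a)).
  by case: ifP; rewrite ?mul1r ?mul0r.
by rewrite -ler_distl lt_neqAle neqa.
Qed.

(** Almost everywhere equality transfers the integral for any measurable [g], without integrability.
    This serves both the probabilistic part and the explicit computation. *)
Lemma integral_mul_chi (R : realType) (a c : R) (g : R -> R) :
  0 < a -> measurable_fun setT g ->
  (\int[lebesgue_measure]_y (g y * chi a c y)%:E =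
   \int[lebesgue_measure]_(y in `[(c - a)%R, (c + a)%R])
     ((2 * a)^-1 * g y)%:E)%E.
Proof.
move=> a0 mg; rewrite [RHS]integral_mkcond.
have -> : ((fun y => ((2 * a)^-1 * g y)%:E) \_ `[(c - a)%R, (c + a)%R])%E =
          (fun y => (g y * uniform_pdf (c - a) (c + a) y)%:E).
  apply/funext => y; rewrite patchE mem_setE in_itv/= /uniform_pdf.
  have -> : c + a - (c - a) = 2 * a by ring.
  by case: ifP; rewrite ?mulr0 // mulrC.
apply: ae_eq_integral => //.
- by apply/measurable_EFinP; apply: measurable_funM => //; exact: measurable_chi.
- apply/measurable_EFinP; apply: measurable_funM => //.
  exact: measurable_uniform_pdf.
by apply: filterS (chi_ae_uniform_pdf c a0) => y /= /(_ I) ->.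
Qed.

(** * Convolution of a bounded density with [chi], as a mean over a uniform variable *)

Section convolution_chi.
Context (R : realType).
Variables (a c M : R) (f : R -> R) (ca : c - a < c + a).
Hypotheses (a_gt0 : 0 < a) (mf : measurable_fun setT f).
Hypothesis f_bounded : forall x, 0 <= f x <= M.

Let mfB (x : R) : measurable_fun setT (fun y : R => f (x - y)).
Proof.
by apply: (measurableT_comp mf); exact: measurable_funB.
Qed.

Lemma integral_uniform_bounded (x : R) :
  (0 <= \int[uniform_prob ca]_y (f (x - y))%:E <= M%:E)%E.
Proof.
apply/andP; split.
  by apply: integral_ge0 => y _; rewrite lee_fin; case/andP: (f_bounded (x - y)).
rewrite -[leRHS]mule1.
rewrite -[X in (_ * X)%E](@probability_setT _ _ _ (uniform_prob ca)).
rewrite -integral_cst//; apply: ge0_le_integral => //.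
- by move=> y _; rewrite lee_fin; case/andP: (f_bounded (x - y)).
- by apply/measurable_EFinP; exact: mfB.
- by move=> y _; rewrite lee_fin; case/andP: (f_bounded (x - y)).
Qed.

(** [convolution] is a real integral, that is, [fine] of an extended one. The bound [M] makes the
    latter finite, so nothing is lost, and Tonelli for nonnegative extended functions becomes
    available. *)
Lemma EFin_convolution_chi (x : R) :
  (convolution f (chi a c) x)%:E = (\int[uniform_prob ca]_y (f (x - y))%:E)%E.
Proof.
have [i0 iM] := andP (integral_uniform_bounded x).
rewrite -[RHS]fineK ?ge0_fin_numE ?(le_lt_trans iM) ?ltry//.
congr EFin; congr fine.
rewrite integral_mul_chi// integral_uniform//; last 2 first.
- by apply/measurable_EFinP; exact: mfB.
- by move=> y; rewrite lee_fin; case/andP: (f_bounded (x - y)).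
have -> : c + a - (c - a) = 2 * a by ring.
rewrite -ge0_integralZl//.
- by apply/measurable_EFinP; apply: measurable_funTS; exact: mfB.
- by move=> y _; rewrite lee_fin; case/andP: (f_bounded (x - y)).
- by rewrite lee_fin invr_ge0 mulr_ge0// ltW.
Qed.

Lemma convolution_chi_bounded (x : R) : 0 <= convolution f (chi a c) x <= M.
Proof. by rewrite -!lee_fin EFin_convolution_chi integral_uniform_bounded. Qed.

Let mf2 : measurable_fun setT (fun z : R * R => (f (z.1 - z.2))%:E).
Proof.
apply/measurable_EFinP; apply: (measurableT_comp mf).
by apply: measurable_funB.
Qed.

Lemma measurable_convolution_chi : measurable_fun setT (convolution f (chi a c)).
Proof.
apply/measurable_EFinP.
rewrite (_ : _ \o _ = fubini_F (uniform_prob ca)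
    (fun z : R * R => (f (z.1 - z.2))%:E)).
  apply: measurable_fun_fubini_tonelli_F => // z.
  by rewrite lee_fin; case/andP: (f_bounded (z.1 - z.2)).
by apply/funext => x /=; rewrite EFin_convolution_chi.
Qed.

Let f0 (x : R) : 0 <= f x.
Proof. by case/andP: (f_bounded x). Qed.

(** The indicator of [B] moves the domain of integration into the integrand, so that Tonelli applies
    on the whole plane. *)
Let h (B : set R) (z : R * R) := (f (z.1 - z.2) * \1_B z.1)%:E.

Let mh (B : set R) : measurable B -> measurable_fun setT (h B).
Proof.
move=> mB; apply/measurable_EFinP; apply: measurable_funM.
  exact/measurable_EFinP.
by apply: (measurableT_comp (measurable_indic mB)).
Qed.

Let h0 (B : set R) z : (0 <= h B z)%E.
Proof. by rewrite lee_fin mulr_ge0. Qed.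

Let hE (B : set R) y : measurable B ->
  (\int[lebesgue_measure]_(x in [set z | B (z + y)%R]) (f x)%:E =
   \int[lebesgue_measure]_x h B (x, y))%E.
Proof.
move=> mB; rewrite -ge0_integral_shift// integral_mkcond.
apply: eq_integral => x _; rewrite patchE /h/= indicE.
by case: ifP; rewrite ?mulr1 ?mulr0.
Qed.

Lemma measurable_integral_translate (B : set R) : measurable B ->
  measurable_fun setT (fun y : R =>
    \int[lebesgue_measure]_(x in [set z | B (z + y)%R]) (f x)%:E)%E.
Proof.
move=> mB; under eq_fun do rewrite hE//.
exact: (measurable_fun_fubini_tonelli_G (m1 := lebesgue_measure)
  _ (mh mB) (h0 B)).
Qed.

(** Tonelli exchanges the two integrals of [h B]. For fixed [y], translation invariance then turns
    the integral of [f (x - y)] over [B] into that of [f] over [B] shifted by [- y]. *)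
Lemma integral_convolution_chi (B : set R) : measurable B ->
  (\int[lebesgue_measure]_(x in B) (convolution f (chi a c) x)%:E =
   \int[uniform_prob ca]_y
     \int[lebesgue_measure]_(x in [set z | B (z + y)%R]) (f x)%:E)%E.
Proof.
move=> mB; rewrite integral_mkcond.
transitivity (\int[lebesgue_measure]_x \int[uniform_prob ca]_y h B (x, y))%E.
  apply: eq_integral => x _; rewrite patchE /h/= indicE.
  case: ifP => xB; rewrite ?EFin_convolution_chi; apply/esym.
    by under eq_integral do rewrite mulr1.
  by under eq_integral do rewrite mulr0; rewrite integral0.
rewrite fubini_tonelli//; last exact: mh.
by apply: eq_integral => y _; rewrite hE.
Qed.

End convolution_chi.

(* [uniform_prob] lives on [measurableTypeR R] and [distribution P Z] on [R]: the
   sigma-algebras agree but not the structures, hence the detour through [P]. *)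
Lemma ge0_integral_uniformly_distributed d (T : measurableType d) (R : realType)
    (P : probability T R) (Z : {RV P >-> R}) (l u : R) (lu : l < u)
    (g : R -> \bar R) :
  (forall B : set R, measurable B -> distribution P Z B = uniform_prob lu B) ->
  measurable_fun setT g -> (forall y, 0 <= g y)%E ->
  (\int[distribution P Z]_y g y = \int[uniform_prob lu]_y g y)%E.
Proof.
move=> ZE mg g0; rewrite ge0_integral_distribution//.
have mZ : measurable_fun setT (Z : T -> measurableTypeR R).
  exact: (measurable_funP Z).
pose Z' : {mfun T >-> measurableTypeR R} :=
  HB.pack (Z : T -> measurableTypeR R) (isMeasurableFun.Build _ _ _ _ _ mZ).
have -> : (\int[P]_x (g \o Z) x = \int[P]_x (g \o Z') x)%E by [].
rewrite -(ge0_integral_distribution (T' := measurableTypeR R) Z' mg g0).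
by apply: eq_measure_integral => B mB _; exact: ZE.
Qed.

(** * Adding an independent uniform variable *)

Section finite_image.
Context d1 d2 (T1 : measurableType d1) (T2 : measurableType d2) (R : realType).
Variables (mu : {finite_measure set T1 -> \bar R}) (f : {mfun T1 >-> T2}).

(** Meant for [P] restricted to an event, which is finite but in general not a probability. The
    separate name carries the finite measure structure that uniqueness of product measures asks of a
    factor. *)
Definition finite_image : set T2 -> \bar R := pushforward mu f.

Let finite_image0 : finite_image set0 = 0%E.
Proof. exact: measure0. Qed.

Let finite_image_ge0 A : (0 <= finite_image A)%E.
Proof. exact: measure_ge0. Qed.

Let finite_image_sigma_additive : semi_sigma_additive finite_image.
Proof. exact: measure_semi_sigma_additive. Qed.

HB.instance Definition _ := isMeasure.Build _ _ _ finite_image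
  finite_image0 finite_image_ge0 finite_image_sigma_additive.

Let finite_image_fin : fin_num_fun finite_image.
Proof.
move=> A mA; apply: fin_num_measure.
by rewrite -[_ @^-1` _]setTI; exact: measurable_funP.
Qed.

HB.instance Definition _ :=
  @Measure_isFinite.Build _ _ _ finite_image finite_image_fin.

End finite_image.

Section add_uniform.
Context d (T : measurableType d) (R : realType) (P : probability T R).
Variables (E : set T) (Y : {mfun T >-> R}) (Z : {RV P >-> R}).
Variables (a c M : R) (f : R -> R) (k : \bar R).
Hypotheses (mE : measurable E) (a_gt0 : 0 < a) (mf : measurable_fun setT f).
Hypothesis f_bounded : forall x, 0 <= f x <= M.
Hypothesis k_ge0 : (0 <= k)%E.
Hypothesis Z_unif : uniformly_distributed Z (c - a) (c + a).
Hypothesis YZ_indep : forall B1 B2 : set R, measurable B1 -> measurable B2 ->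
  P (Y @^-1` B1 `&` Z @^-1` B2 `&` E) =
  (\int[lebesgue_measure]_(x in B1) (f x)%:E * P (Z @^-1` B2) * k)%E.

(** [E] is meant as an event about further variables and [k] as its probability. By [YZ_indep], the
    joint law of [Y] and [Z] under [P] restricted to [E] agrees with a product measure on
    rectangles, hence everywhere. Integrating its sections over the law of [Z] gives the
    convolution. *)
Lemma probability_add_uniform (B : set R) : measurable B ->
  P ([set w | B (Y w + Z w)] `&` E) =
  (\int[lebesgue_measure]_(x in B) (convolution f (chi a c) x)%:E * k)%E.
Proof.
move=> mB; have [ca Z_unifE] := Z_unif.
pose YZ (w : T) : R * R := (Y w, Z w).
have mYZ : measurable_fun setT YZ by exact: measurable_fun_pair.
pose mYZ_mixin := isMeasurableFun.Build _ _ _ _ _ mYZ.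
pose mYZ_pack : {mfun T >-> (R * R)%type} := HB.pack YZ mYZ_mixin.
pose A := [set z : R * R | B (z.1 + z.2)].
have mA : measurable A.
  by rewrite -[A]setTI; apply: measurable_funD.
have -> : P ([set w | B (Y w + Z w)] `&` E) =
          finite_image (mrestr P mE) mYZ_pack A by [].
have imYE (B1 : set R) : measurable B1 -> finite_image (mrestr P mE) Y B1 =
    (\int[lebesgue_measure]_(x in B1) (f x)%:E * k)%E.
  (* Taking the whole line for [Z] leaves the law of [Y] on [E], with density [f] scaled by [k]. *)
  move=> mB1; have := YZ_indep mB1 measurableT.
  by rewrite preimage_setT setIT probability_setT mule1.
pose unique := @product_measure_unique _ _ R R R
  (finite_image (mrestr P mE) Y) (distribution P Z).
rewrite -(unique (finite_image (mrestr P mE) mYZ_pack))//; last first.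
  move=> B1 B2 mB1 mB2.
  by have := YZ_indep mB1 mB2; rewrite muleAC -imYE.
(* Uniqueness is used a second time to pass to [\x^], which integrates over the value of [Z] on the
   outside. *)
rewrite (unique (finite_image (mrestr P mE) Y \x^ distribution P Z)%E)//;
  last by move=> B1 B2 mB1 mB2; exact: product_measure2E.
transitivity (\int[distribution P Z]_y
    (\int[lebesgue_measure]_(x in [set z | B (z + y)%R]) (f x)%:E * k))%E.
  apply: eq_integral => y _; rewrite /= -imYE; last exact: measurable_preimageD.
  by congr (_ _); apply/seteqP; split=> x; rewrite /ysection/= inE.
have mI := measurable_integral_translate mf f_bounded mB.
have I_ge0 (y : R) : (0 <=
    \int[lebesgue_measure]_(x in [set z | B (z + y)%R]) (f x)%:E)%E.
  by apply: integral_ge0 => x _; rewrite lee_fin; case/andP: (f_bounded x).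
rewrite !ge0_integralZr//; congr (_ * k)%E.
rewrite (ge0_integral_uniformly_distributed Z_unifE)//.
by rewrite (integral_convolution_chi ca a_gt0 mf f_bounded).
Qed.

End add_uniform.

(** * Density of a sum of independent uniform variables *)

Lemma nfold_convolution_rcons (R : realType) (s : seq (R -> R)) (f : R -> R) :
  s != [::] ->
  nfold_convolution (rcons s f) = convolution (nfold_convolution s) f.
Proof. by case: s => // g s _; rewrite /= foldl_rcons. Qed.

Section sum_uniform.
Context d (T : measurableType d) (R : realType) (P : probability T R).
Variables (I : finType) (a c : I -> R) (X : I -> {RV P >-> R}).
Hypothesis a_gt0 : forall i, 0 < a i.

Let density (s : seq I) : R -> R :=
  nfold_convolution [seq chi (a i) (c i) | i <- s].

Let density_rcons (s : seq I) i : s != [::] ->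
  density (rcons s i) = convolution (density s) (chi (a i) (c i)).
Proof.
move=> s0; rewrite /density map_rcons nfold_convolution_rcons//.
by case: s s0.
Qed.

(** Each further convolution is a mean of translates, so the bound [(2 * a i)^-1] of the first
    density in the list survives every step. Lists grow on the right because the convolution is
    bracketed to the left. *)
Lemma nfold_chi_measurable_bounded (s : seq I) : s != [::] ->
  measurable_fun setT (density s) /\
  exists M, forall x, 0 <= density s x <= M.
Proof.
elim/last_ind: s => // s i IHs _; have [->|s0] := eqVneq s [::].
  split; first exact: measurable_chi.
  by exists (2 * a i)^-1 => x; rewrite chi_ge0 ?chi_le.
have [ms [M sM]] := IHs s0; rewrite density_rcons//.
have ca : c i - a i < c i + a i by have := a_gt0 i; lra.
split; first exact: (measurable_convolution_chi ca (a_gt0 i) ms sM).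
exists M => x; exact: (convolution_chi_bounded ca (a_gt0 i) ms sM).
Qed.

Hypothesis X_indep : mutually_independent X.
Hypothesis X_unif : forall i,
  uniformly_distributed (X i) (c i - a i) (c i + a i).

Lemma probability_uniform (i : I) (B : set R) : measurable B ->
  P (X i @^-1` B) = (\int[lebesgue_measure]_(x in B) (chi (a i) (c i) x)%:E)%E.
Proof.
move=> mB; have [ca XE] := X_unif i.
rewrite -[LHS]/(distribution P (X i) B) XE//; apply: ae_eq_integral => //.
- apply/measurable_EFinP; apply: measurable_funTS.
  exact: measurable_uniform_pdf.
- by apply/measurable_EFinP; apply: measurable_funTS; exact: measurable_chi.
by apply: filterS (chi_ae_uniform_pdf (c i) (a_gt0 i)) => x /= /(_ Logic.I) ->.
Qed.

(* The variables outside [s] are kept in the statement, so that each of them is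
   still available as an independent summand at the next induction step. *)
Lemma probability_sum_uniform (s : seq I) (J : {set I}) (B : I -> set R)
    (D : set R) :
  s != [::] -> uniq s -> {in s, forall i, i \notin J} ->
  (forall i, measurable (B i)) -> measurable D ->
  P ([set w | D (\sum_(i <- s) X i w)] `&`
     \bigcap_(i in [set` J]) (X i @^-1` B i)) =
  (\int[lebesgue_measure]_(x in D) (density s x)%:E *
   \prod_(i in J) P (X i @^-1` B i))%E.
Proof.
(* As [i] lies outside [J'], the set prescribed for [X i] can be chosen freely: its event is
   absorbed into the intersection over a larger index set. *)
have indepU1 i (J' : {set I}) (D' : set R) (B' : I -> set R) : i \notin J' ->
    (forall j, measurable (B' j)) -> measurable D' ->
    exists B'' : I -> set R, [/\ (forall j, measurable (B'' j)),
      X i @^-1` D' `&` \bigcap_(j in [set` J']) (X j @^-1` B' j) =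
      \bigcap_(j in [set` (i |: J')%SET]) (X j @^-1` B'' j) &
      (\prod_(j in (i |: J')%SET) P (X j @^-1` B'' j) =
      P (X i @^-1` D') * \prod_(j in J') P (X j @^-1` B' j))%E].
  move=> iJ mB mD; exists (fun j => if j == i then D' else B' j); split.
  - by move=> j; case: ifP => _; [exact: mD|exact: mB].
  - apply/seteqP; split=> w /=.
      move=> [Dw Bw] j /=; rewrite in_setU1; case: eqP => [->//|_] /= jJ.
      exact: Bw.
    move=> Bw; split; first by have := Bw i; rewrite /= setU11 eqxx; apply.
    move=> j /= jJ; have := Bw j; rewrite /= in_setU1 jJ orbT => /(_ isT).
    by rewrite ifN//; apply: contraNneq iJ => <-.
  - rewrite big_setU1//= eqxx; congr (_ * _)%E; apply: eq_bigr => j jJ.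
    by rewrite ifN//; apply: contraNneq iJ => <-.
elim/last_ind: s J B D => // s i IHs J B D _.
rewrite rcons_uniq => /andP[is_ us] sJ mB mD.
have iJ : i \notin J by apply: sJ; rewrite mem_rcons mem_head.
have [s0|s0] := eqVneq s [::].
  have [B' [mB' capE prodE]] := indepU1 i J D B iJ mB mD.
  have -> : [set w | D (\sum_(j <- rcons s i) X j w)] = X i @^-1` D.
    by apply/funext => w; rewrite /preimage/= s0 big_seq1.
  rewrite capE X_indep// prodE s0 /density/=.
  by rewrite -probability_uniform.
have [ms [M sM]] := nfold_chi_measurable_bounded s0.
have sJ' : {in s, forall j, j \notin J}.
  by move=> j js; apply: sJ; rewrite mem_rcons inE js orbT.
have mE : measurable (\bigcap_(j in [set` J]) (X j @^-1` B j)).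
  apply: fin_bigcap_measurable => // j _.
  by rewrite -[X in measurable X]setTI; exact: measurable_funP.
have mS : measurable_fun setT (fun w => \sum_(j <- s) X j w).
  exact: measurable_sum.
pose S : {mfun T >-> R} := HB.pack (fun w => \sum_(j <- s) X j w)
  (isMeasurableFun.Build _ _ _ _ _ mS).
have -> : [set w | D (\sum_(j <- rcons s i) X j w)] =
          [set w | D (S w + X i w)].
  by apply/funext => w; rewrite /= -cats1 big_cat big_seq1.
rewrite density_rcons//.
(* Here [E] is the event prescribed on [J], and [k] the product of the corresponding
   probabilities. *)
apply: (probability_add_uniform (Y := S) (Z := X i) mE (a_gt0 i) ms sM) => //.
- exact: prode_ge0.
- move=> B1 B2 mB1 mB2.
  (* The required product form is the induction hypothesis for [s] with [i] added to [J]. *)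
  have [B' [mB' capE prodE]] := indepU1 i J B2 B iJ mB mB2.
  rewrite -setIA capE -muleA -prodE; apply: IHs => // j js.
  rewrite in_setU1 negb_or sJ'// andbT.
  by apply: contraNneq is_ => <-.
Qed.

Lemma is_density_sum_uniform (s : seq I) : s != [::] -> uniq s ->
  is_density P (fun w => \sum_(i <- s) X i w) (density s).
Proof.
move=> s0 us; have [ms [M sM]] := nfold_chi_measurable_bounded s0.
split=> //; first by move=> x; case/andP: (sM x).
(* For empty [J] the intersection is the whole space and the product is 1. *)
move=> B mB; have := @probability_sum_uniform s finset.set0 (fun=> setT) B s0 us.
rewrite big_set0 mule1 => <- //; last by move=> i; rewrite inE.
by congr (P _); apply/seteqP; split=> w //= [].
Qed.

End sum_uniform.

(** * Integrals of powers times signs *)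

Section sign_power.
Context (R : realType).
Implicit Types (t u v x y : R) (k : nat).

Local Notation mu := (@lebesgue_measure R).

Lemma continuous_subX t k : continuous (fun y : R => (t - y) ^+ k).
Proof.
move=> y; apply: (@cvg_comp _ _ _ (fun z : R => t - z) (fun z => z ^+ k)).
  by apply: cvgB; [exact: cvg_cst|exact: cvg_id].
exact: exprn_continuous.
Qed.

Lemma measurable_subX t k (D : set R) :
  measurable_fun D (fun y : R => (t - y) ^+ k).
Proof. by apply: measurable_funX; exact: measurable_funB. Qed.

Lemma is_derive_subX t k y :
  is_derive y 1 ((- k.+1%:R^-1) *: (cst t - id : R -> R) ^+ k.+1)
    ((t - y) ^+ k).
Proof.
apply: is_derive_eq; rewrite /GRing.scale/= ?fctE sub0r.
by rewrite mulrN1 mulNr mulrN opprK mulrA mulVf ?mul1r ?pnatr_eq0.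
Qed.

Lemma integral_subX t u v k : u <= v ->
  (\int[mu]_(y in `[u, v]) ((t - y) ^+ k)%:E =
   (((t - u) ^+ k.+1 - (t - v) ^+ k.+1) / k.+1%:R)%:E)%E.
Proof.
(* The fundamental theorem of calculus is applied to a nondegenerate interval; the one-point case is
   treated apart. *)
rewrite le_eqVlt => /predU1P[<-|uv].
  by rewrite set_itv1 integral_set1 subrr mul0r.
have dF y := is_derive_subX t k y.
have cF : continuous ((- k.+1%:R^-1) *: (cst t - id : R -> R) ^+ k.+1).
  by move=> y; apply/differentiable_continuous/derivable1_diffP; case: (dF y).
rewrite (continuous_FTC2 (F := (- k.+1%:R^-1) *: (cst t - id) ^+ k.+1) uv).
- rewrite -EFinB; congr EFin; rewrite !fctE /GRing.scale/=; ring.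
- by apply: continuous_subspaceT; exact: continuous_subX.
- split.
  + by move=> y _; case: (dF y).
  + by apply: cvg_at_right_filter; exact: cF.
  + by apply: cvg_at_left_filter; exact: cF.
- by move=> y _; rewrite derive1E; case: (dF y).
Qed.

Lemma measurable_subX_sg t k (D : set R) :
  measurable_fun D (fun y : R => (t - y) ^+ k * Num.sg (t - y)).
Proof.
apply: measurable_funM; first exact: measurable_subX.
rewrite (_ : (fun y => _) =
    fun y => if t == y then 0 else if t < y then -1 else 1).
  apply: measurable_funTS; apply: measurable_fun_if => //.
    exact: measurable_fun_eqr.
  apply: measurable_funTS; apply: measurable_fun_if => //.
  exact: measurable_fun_ltr.
apply/funext => y; have [ty|yt|->] := ltgtP t y.
- by rewrite ltr0_sg ?subr_lt0.
- by rewrite gtr0_sg ?subr_gt0.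
- by rewrite subrr sgr0.
Qed.

Lemma integrable_subX t u v k :
  mu.-integrable `[u, v] (fun y : R => ((t - y) ^+ k)%:E).
Proof.
apply: continuous_compact_integrable; first exact: segment_compact.
by apply: continuous_subspaceT; exact: continuous_subX.
Qed.

Lemma integrable_subX_sg t u v k :
  mu.-integrable `[u, v] (fun y : R => ((t - y) ^+ k * Num.sg (t - y))%:E).
Proof.
apply: le_integrable (integrable_subX t u v k) => //.
- by apply/measurable_EFinP; exact: measurable_subX_sg.
- move=> y _; rewrite lee_fin normrM normr_sg ler_piMr//.
  by case: eqP.
Qed.

(** The sign is prescribed on the open interval only, since it vanishes at [t], which may be an
    endpoint; endpoints do not change the integral. *)
Let integral_constant_sg t u v k (e : R) : u <= v ->
  {in `]u, v[, forall y, Num.sg (t - y) = e} ->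
  (\int[mu]_(y in `[u, v]) ((t - y) ^+ k * Num.sg (t - y))%:E =
   (e * (((t - u) ^+ k.+1 - (t - v) ^+ k.+1) / k.+1%:R))%:E)%E.
Proof.
move=> uv sgE; rewrite integral_itv_bndoo; last first.
  by apply/measurable_EFinP; exact: measurable_subX_sg.
rewrite EFinM -integral_subX// [X in (_ * X)%E]integral_itv_bndoo; last first.
  by apply/measurable_EFinP; exact: measurable_subX.
rewrite -integralZl//; last first.
  apply: integrableS (integrable_subX t u v k) => //; exact: subset_itv_oo_cc.
by apply: eq_integral => y; rewrite inE/= => /sgE ->; rewrite -EFinM mulrC.
Qed.

(** On either side of [t] the sign is constant and factors out. The two pieces fit together because
    the power [k.+1] vanishes at [t], even when [k = 0] and the integrand jumps there. *)
Lemma integral_subX_sg t u v k : u <= v ->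
  (\int[mu]_(y in `[u, v]) ((t - y) ^+ k * Num.sg (t - y))%:E =
   (((t - u) ^+ k.+1 * Num.sg (t - u) - (t - v) ^+ k.+1 * Num.sg (t - v))
    / k.+1%:R)%:E)%E.
Proof.
move=> uv; have [tu|ut] := leP t u.
  rewrite (@integral_constant_sg _ _ _ _ (-1))//; last first.
    move=> y; rewrite in_itv/= => /andP[uy _].
    by rewrite ltr0_sg// subr_lt0 (le_lt_trans tu).
  congr EFin.
  have sgN w : t <= w -> (t - w) ^+ k.+1 * Num.sg (t - w) = - (t - w) ^+ k.+1.
    rewrite le_eqVlt => /predU1P[->|tw].
      by rewrite subrr expr0n mul0r oppr0.
    by rewrite ltr0_sg ?subr_lt0// mulrN1.
  by rewrite !sgN ?(le_trans tu)//; ring.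
have sgP w : w <= t -> (t - w) ^+ k.+1 * Num.sg (t - w) = (t - w) ^+ k.+1.
  rewrite le_eqVlt => /predU1P[->|tw]; first by rewrite subrr expr0n mul0r.
  by rewrite gtr0_sg ?subr_gt0// mulr1.
rewrite sgP ?(ltW ut)//; have [vt|tv] := leP v t.
  rewrite (@integral_constant_sg _ _ _ _ 1)//.
    by rewrite sgP// mul1r.
  move=> y; rewrite in_itv/= => /andP[_ yv].
  by rewrite gtr0_sg// subr_gt0 (lt_le_trans yv).
(* In the remaining case [u < t < v], the interval is cut at the jump. *)
rewrite (@itv_bndbnd_setU _ _ _ (BLeft t)) ?bnd_simp ?(ltW ut) ?(ltW tv)//.
rewrite integral_setU_EFin//=; last 2 first.
- exact: measurable_subX_sg.
- apply/disj_setPS => y [/=]; rewrite !in_itv/= => /andP[_ yt] /andP[].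
  by rewrite leNgt yt.
rewrite integral_itv_bndo_bndc; last first.
  by apply/measurable_EFinP; exact: measurable_subX_sg.
rewrite (@integral_constant_sg _ _ _ _ 1) ?(ltW ut)//; last first.
  by move=> y; rewrite in_itv/= => /andP[_ yt]; rewrite gtr0_sg ?subr_gt0.
rewrite (@integral_constant_sg _ _ _ _ (-1)) ?(ltW tv)//; last first.
  by move=> y; rewrite in_itv/= => /andP[ty _]; rewrite ltr0_sg ?subr_lt0.
rewrite -EFinD; congr EFin.
(* The boundary terms at [t] are zero; the sign -1 at [v] accounts for the term left by the right
   piece. *)
by rewrite subrr (expr0n _ k.+1) ltr0_sg ?subr_lt0//=; ring.
Qed.

End sign_power.

(** * Sums over sign vectors, by their last coordinate *)

Definition ffun_rcons (A : Type) (m : nat) (e : {ffun 'I_m -> A}) (b : A) :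
    {ffun 'I_m.+1 -> A} :=
  [ffun i => if unlift ord_max i is Some j then e j else b].

Lemma ffun_rcons_widen (A : Type) m (e : {ffun 'I_m -> A}) b j :
  ffun_rcons e b (widen_ord (leqnSn m) j) = e j.
Proof.
have -> : widen_ord (leqnSn m) j = lift ord_max j.
  by apply/val_inj; rewrite /= /bump leqNgt ltn_ord.
by rewrite ffunE liftK.
Qed.

Lemma ffun_rcons_max (A : Type) m (e : {ffun 'I_m -> A}) b :
  ffun_rcons e b ord_max = b.
Proof. by rewrite ffunE unlift_none. Qed.

(** Restriction to the first [m] coordinates together with the last value is a bijection onto pairs,
    inverse to [ffun_rcons]. *)
Lemma sum_ffun_bool_recr (V : zmodType) m (F : {ffun 'I_m.+1 -> bool} -> V) :
  \sum_e F e =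
  \sum_(e : {ffun 'I_m -> bool})
    (F (ffun_rcons e true) + F (ffun_rcons e false)).
Proof.
pose h (p : {ffun 'I_m -> bool} * bool) := ffun_rcons p.1 p.2.
pose g (e : {ffun 'I_m.+1 -> bool}) :=
  ([ffun j => e (widen_ord (leqnSn m) j)], e ord_max)
  : {ffun 'I_m -> bool} * bool.
have hK : cancel h g.
  move=> [e b]; rewrite /g /h/= ffun_rcons_max; congr (_, _).
  by apply/ffunP => j; rewrite ffunE ffun_rcons_widen.
have gK : cancel g h.
  move=> e; apply/ffunP => i; rewrite /h /g ffunE/=.
  case: unliftP => [j ->|->//]; rewrite ffunE; congr (e _).
  by apply/val_inj; rewrite /= /bump leqNgt ltn_ord.
rewrite (reindex h)/=; last by exists g => ? _; [exact: hK|exact: gK].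
rewrite -(pair_bigA _ (fun e b => F (ffun_rcons e b)))/=.
by apply: eq_bigr => e _; rewrite big_bool.
Qed.

Lemma sum_ffun0 (V : zmodType) (A : finType) (F : {ffun 'I_0 -> A} -> V)
    (e0 : {ffun 'I_0 -> A}) : \sum_e F e = F e0.
Proof.
by rewrite (big_pred1 e0)// => e; apply/esym/eqP/ffunP; case.
Qed.

(** * The closed formula *)

(** The difference of signs is 2 inside, 1 at the endpoints and 0 outside, which is twice the
    numerator of [chi]. The averaged values at the jumps make this exact everywhere, and it is the
    formula for one variable. *)
Lemma chi_sg (R : realType) (a c x : R) : 0 < a ->
  chi a c x = (Num.sg (x - c + a) - Num.sg (x - c - a)) / (4 * a).
Proof.
move=> a0; rewrite /chi.
have -> : (4 * a)^-1 = 2^-1 * (2 * a)^-1 by rewrite -invfM; congr (_^-1); ring.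
rewrite mulrA; congr (_ * _); set y := x - c.
rewrite ltr_norml eqr_norml (ltW a0) andbT.
have [ya|ya|->] := ltgtP y a.
- have [yNa|yNa|yNa] := ltgtP (- a) y => /=.
  + by rewrite (@gtr0_sg _ (y + a)) ?(@ltr0_sg _ (y - a)); lra.
  + by rewrite (@ltr0_sg _ (y + a)) ?(@ltr0_sg _ (y - a)); lra.
  + by rewrite -yNa addNr sgr0 ltr0_sg; lra.
- rewrite andbF /= gt_eqF /=; last by lra.
  by rewrite (@gtr0_sg _ (y + a)) ?(@gtr0_sg _ (y - a)); lra.
- by rewrite andbF subrr sgr0 gtr0_sg /=; lra.
Qed.

Lemma nfold_chiE (R : realType) m (a c : 'I_m.+1 -> R) (x : R) :
  (forall j, 0 < a j) ->
  nfold_convolution [seq chi (a j) (c j) | j <- enum 'I_m.+1] x =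
  (\sum_(eps : {ffun 'I_m.+1 -> bool})
     (x + \sum_j (sign_of R (eps j) * a j - c j)) ^+ m
     * Num.sg (x + \sum_j (sign_of R (eps j) * a j - c j))
     * \prod_j sign_of R (eps j))
  / (m`!%:R * 2 ^+ m.+2 * \prod_j a j).
Proof.
elim: m a c x => [|m IHm] a c x a_gt0.
  rewrite enum_ordSr [enum 'I_0]size0nil ?size_enum_ord//= chi_sg//.
  rewrite sum_ffun_bool_recr (sum_ffun0 _ [ffun=> true]).
  rewrite !big_ord_recr !big_ord0/= !ffun_rcons_max/=.
  rewrite fact0 !expr0 !mul1r !mulN1r !add0r ?mulrN1 ?mulr1.
  congr (_ / _); last by ring.
  by congr (Num.sg _ - Num.sg _); ring.
pose w := widen_ord (leqnSn m.+1); pose a' j := a (w j); pose c' j := c (w j).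
pose f := nfold_convolution [seq chi (a' j) (c' j) | j <- enum 'I_m.+1].
have enum0 : enum 'I_m.+1 != [::] by rewrite -size_eq0 size_enum_ord.
have -> : nfold_convolution [seq chi (a j) (c j) | j <- enum 'I_m.+2] x =
          convolution f (chi (a ord_max) (c ord_max)) x.
  rewrite enum_ordSr map_rcons -map_comp nfold_convolution_rcons//.
  by rewrite -size_eq0 size_map size_enum_ord.
have [mf _] := nfold_chi_measurable_bounded c' (fun j => a_gt0 (w j)) enum0.
set u := a ord_max; set v := c ord_max.
have u0 : 0 < u by exact: a_gt0.
pose t (e : {ffun 'I_m.+1 -> bool}) :=
  x + \sum_j (sign_of R (e j) * a' j - c' j).
(* [K e] is the coefficient of the term of [e] in the induction hypothesis, times the height of the
   last [chi]. *)
pose K (e : {ffun 'I_m.+1 -> bool}) := (2 * u)^-1 *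
  (\prod_j sign_of R (e j) / (m`!%:R * 2 ^+ m.+2 * \prod_j a' j)).
rewrite /convolution /Rintegral integral_mul_chi//; last first.
  by apply: (measurableT_comp mf); exact: measurable_funB.
transitivity (fine (\int[lebesgue_measure]_(y in `[(v - u)%R, (v + u)%R])
    \sum_e ((K e)%:E * ((t e - y) ^+ m * Num.sg (t e - y))%:E))%E).
  congr fine; apply: eq_integral => y _.
  rewrite -/f /f IHm; last by move=> j; exact: a_gt0.
  rewrite sumEFin; congr EFin; rewrite mulr_suml mulr_sumr.
  apply: eq_bigr => e _.
  have <- : x - y + \sum_j (sign_of R (e j) * a' j - c' j) = t e - y.
    by rewrite /t; ring.
  by rewrite /K; ring.
rewrite integral_sum//; last first.
  by move=> e; apply: integrableZl => //; exact: integrable_subX_sg.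
have vu : v - u <= v + u by lra.
rewrite (eq_bigr (fun e => (K e *
    (((t e - (v - u)) ^+ m.+1 * Num.sg (t e - (v - u)) -
      (t e - (v + u)) ^+ m.+1 * Num.sg (t e - (v + u))) / m.+1%:R))%:E));
  last first.
  move=> e _; rewrite [RHS]EFinM -integral_subX_sg// -integralZl//.
  exact: integrable_subX_sg.
(* The terms are now compared for each [e]: the two boundary values of the integral against the two
   extensions of [e] by a last sign. *)
rewrite sumEFin /= [in RHS]sum_ffun_bool_recr mulr_suml; apply: eq_bigr => e _.
have tE b : x + \sum_(j < m.+2) (sign_of R (ffun_rcons e b j) * a j - c j) =
    t e + (sign_of R b * u - v).
  rewrite big_ord_recr/= ffun_rcons_max addrA; congr (_ + _ + _).
  by apply: eq_bigr => j _; rewrite ffun_rcons_widen.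
have pE b : \prod_(j < m.+2) sign_of R (ffun_rcons e b j) =
    \prod_j sign_of R (e j) * sign_of R b.
  rewrite big_ord_recr/= ffun_rcons_max; congr (_ * _).
  by apply: eq_bigr => j _; rewrite ffun_rcons_widen.
have aE : \prod_(j < m.+2) a j = \prod_j a' j * u by rewrite big_ord_recr.
have factE : (m.+1)`!%:R = m.+1%:R * m`!%:R :> R by rewrite factS natrM.
(* The extra factors of the denominator are [m.+1] from the primitive and [2 * u] from the height of
   [chi]. *)
rewrite !tE !pE aE factE (exprS 2 m.+2).
rewrite (_ : sign_of R true = 1)// (_ : sign_of R false = -1)//.
(* The sign 1 corresponds to the lower endpoint [v - u] and -1 to the upper one, whose boundary term
   is the subtracted one. *)
have -> : t e + (1 * u - v) = t e - (v - u) by ring.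
have -> : t e + (-1 * u - v) = t e - (v + u) by ring.
by rewrite /K !invfM; ring.
Qed.

Theorem theorem1 (R : realType) (d : measure_display) (T : measurableType d)
    (P : probability T R) (n : nat) (a c : 'I_n -> R) (X : 'I_n -> {RV P >-> R})
    (n_gt0 : (0 < n)%N)
    (a_gt0 : forall j, 0 < a j)
    (X_indep : mutually_independent X)
    (X_unif : forall j, uniformly_distributed (X j) (c j - a j) (c j + a j)) :
  let f_n := nfold_convolution [seq chi (a j) (c j) | j <- enum 'I_n] in
  is_density P (fun w => \sum_(j < n) X j w) f_n /\
  forall x : R,
    f_n x =
    (\sum_(eps : {ffun 'I_n -> bool})
       (x + \sum_(j < n) (sign_of R (eps j) * a j - c j)) ^+ (n - 1)
       * Num.sg (x + \sum_(j < n) (sign_of R (eps j) * a j - c j))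
       * \prod_(j < n) sign_of R (eps j))
    / ((n - 1)`!%:R * 2 ^+ (n + 1) * \prod_(j < n) a j).
Proof.
case: n n_gt0 a c X a_gt0 X_indep X_unif => // m _ a c X a_gt0 X_indep X_unif.
split; last by move=> x; rewrite subn1 addn1 /= nfold_chiE.
have enum0 : enum 'I_m.+1 != [::] by rewrite -size_eq0 size_enum_ord.
have := is_density_sum_uniform a_gt0 X_indep X_unif enum0 (enum_uniq _).
congr is_density; apply/funext => w; exact: big_enum.
Qed.
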